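(* Let $X=X_1\times X_2$ and $Y=Y_1\times Y_2$ be products of Polish spaces, let $\mu\in\mathcal{P}(X)$, $\nu\in\mathcal{P}(Y)$, and let $c=c_1+c_2:X\times Y\to[0,\infty)$ be a lower semicontinuous separable cost function. Assume that the optimal transportation problem between $\mu$ and $\nu$ with cost $c$ has a unique solution $\pi\in\Pi(\mu,\nu)$. Let $(\xi_1,\xi_2,\eta_1,\eta_2)$ be a random vector with values in $X_1\times X_2\times Y_1\times Y_2$ and law $\pi$. Then: 1. $\xi_1$ and $\eta_2$ are conditionally independent given $(\xi_2,\eta_1)$; 2. $\xi_2$ and $\eta_1$ are conditionally independent given $(\xi_1,\eta_2)$.
   Context: $\mathcal{P}(Z)$ denotes the Borel probability measures on a Polish space $Z$. $\Pi(\mu,\nu)$ is the set of probability measures on $X\times Y$ with marginals $\mu$ on $X$ and $\nu$ on $Y$. A solution of the optimal transportation problem is a minimizer of $\pi\mapsto\int_{X\times Y}c\,d\pi$ over $\Pi(\mu,\nu)$. Separable cost: $c(\mathbf{x},\mathbf{y})=c_1(x_1,y_1)+c_2(x_2,y_2)$ for $\mathbf{x}=(x_1,x_2)\in X$, $\mathbf{y}=(y_1,y_2)\in Y$, with $c_1:X_1\times Y_1\to\mathbb{R}$ and $c_2:X_2\times Y_2\to\mathbb{R}$. *)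

(* Defs.v *)
From HB Require Import structures.
From mathcomp Require Import all_boot all_order all_algebra.
From mathcomp Require Import all_classical all_reals all_analysis.

Set Implicit Arguments.
Unset Strict Implicit.
Unset Printing Implicit Defensive.

Import Order.TTheory GRing.Theory Num.Theory.
Import numFieldNormedType.Exports.

Local Open Scope classical_set_scope.
Local Open Scope ring_scope.

(* The library does not combine its pointed and topological structures on
   products. *)
HB.instance Definition _ (X Y : ptopologicalType) :=
  Pointed.on (X * Y)%type.

(* d x y >= 0 follows from the first three clauses. *)
Definition complete_compatible_metric (R : realType) (T : topologicalType)
    (d : T -> T -> R) : Prop :=
  [/\ forall x y, d x y = 0 <-> x = y,
      forall x y, d x y = d y x,
      forall x y z, d x z <= d x y + d y z,
      forall (x : T) (A : set T),
        nbhs x A <-> exists2 e : R, 0 < e & [set y | d x y < e] `<=` A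
    & forall u : nat -> T,
        (forall e : R, 0 < e -> exists N : nat, forall m n : nat,
          (N <= m)%N -> (N <= n)%N -> d (u m) (u n) < e) ->
        exists l : T, u @ \oo --> l].

(* The metric is existentially quantified
   and only has to induce the given topology. *)
Definition polish (R : realType) (T : topologicalType) : Prop :=
  (exists2 D : set T, countable D & dense D) /\
  exists d : T -> T -> R, complete_compatible_metric d.

(* On a product X * Y this is the Borel sigma-algebra of the product topology,
   and not the product measurable structure of the library (the two agree for
   second countable spaces). *)
Definition borel (T : ptopologicalType) : measurableType (@open T).-sigma :=
  g_sigma_algebraType (@open T).

Section transport.
Context {R : realType} {X Y : ptopologicalType}.
Variables (mu : probability (borel X) R) (nu : probability (borel Y) R).

(* Equalities of measures are stated on measurable sets only: the values of a
   measure of the library on other sets are irrelevant. *)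
Definition coupling (pi : probability (borel (X * Y)%type) R) : Prop :=
  (forall A : set (borel X), measurable A ->
     pushforward pi (fst : borel (X * Y)%type -> borel X) A = mu A) /\
  (forall B : set (borel Y), measurable B ->
     pushforward pi (snd : borel (X * Y)%type -> borel Y) B = nu B).

Variable c : X * Y -> R.

Definition transport_cost (pi : probability (borel (X * Y)%type) R) : \bar R :=
  (\int[pi]_z (c z)%:E)%E.

Definition optimal_plan (pi : probability (borel (X * Y)%type) R) : Prop :=
  coupling pi /\
  forall pi', coupling pi' -> (transport_cost pi <= transport_cost pi')%E.

Definition unique_optimal_plan (pi : probability (borel (X * Y)%type) R) :=
  optimal_plan pi /\
  forall pi', optimal_plan pi' ->
    forall A : set (borel (X * Y)%type), measurable A -> pi' A = pi A.

End transport.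

Definition separable_cost (R : realType) (X1 X2 Y1 Y2 : Type)
    (c1 : X1 * Y1 -> R) (c2 : X2 * Y2 -> R) (z : (X1 * X2) * (Y1 * Y2)) : R :=
  c1 (z.1.1, z.2.1) + c2 (z.1.2, z.2.2).

Section conditional_independence.
Context {R : realType} {d d1 d2 d3 : measure_display}.
Context {Omega : measurableType d} (P : probability Omega R).
Context {T1 : measurableType d1} {T2 : measurableType d2}.
Context {T3 : measurableType d3}.

(* f is a version of the conditional probability P(E | sigma(zeta)). *)
Definition is_cond_prob (zeta : Omega -> T3) (E : set Omega)
    (f : Omega -> R) : Prop :=
  [/\ measurable_fun [set: g_sigma_algebra_preimageType zeta]
        (f : g_sigma_algebra_preimageType zeta -> R),
      P.-integrable [set: Omega] (EFin \o f)
    & forall C : set Omega, g_sigma_algebra_preimage zeta C ->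
        (\int[P]_(w in C) (f w)%:E = P (E `&` C))%E].

(* P(xi in A, eta in B | zeta) = P(xi in A | zeta) P(eta in B | zeta) a.s.
   Versions are unique up to P-null sets, so that one choice of versions
   satisfies the equation iff all choices do. *)
Definition cond_independent (xi : Omega -> T1) (eta : Omega -> T2)
    (zeta : Omega -> T3) : Prop :=
  forall (A : set T1) (B : set T2), measurable A -> measurable B ->
  exists f g h : Omega -> R,
    [/\ is_cond_prob zeta (xi @^-1` A `&` eta @^-1` B) f,
        is_cond_prob zeta (xi @^-1` A) g,
        is_cond_prob zeta (eta @^-1` B) h
      & {ae P, forall w, f w = g w * h w}].

End conditional_independence.

(* Main.v *)
(** Resample [xi1] from its conditional law given [(xi2, eta1)], independently of
    [eta2], and keep the other coordinates.  The laws of the pairs [(xi1, xi2)],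
    [(eta1, eta2)], [(xi1, eta1)] and [(xi2, eta2)] do not change, hence neither
    do the marginals nor, the cost being separable, the cost.  By uniqueness the
    new vector has law [pi], which is the first conditional independence; the
    second one is symmetric.

    Resampling requires a measure [M] on [X1 * Omega] with
    [M (A * C)] the integral over [C] of [P (xi1 in A | xi2, eta1)].  This
    expression is a measure in [A] and in [C] separately; by inner regularity of
    the law of [xi1] with respect to compact sets (Ulam) it is countably
    subadditive on rectangles, so that it extends to the product sigma-algebra
    by Caratheodory's theorem, without regular conditional probabilities. *)

Require Import Defs.
From HB Require Import structures.
From mathcomp Require Import all_boot all_order all_algebra finmap.
From mathcomp Require Import all_classical all_reals all_analysis.
From mathcomp Require Import measurable_realfun lra.

Set Implicit Arguments.
Unset Strict Implicit.
Unset Printing Implicit Defensive.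

Import Order.TTheory GRing.Theory Num.Theory.
Import numFieldNormedType.Exports.

Local Open Scope classical_set_scope.
Local Open Scope ring_scope.

(** * Countable bases of Polish spaces and Borel sets of products *)

Lemma mball_open (R : realType) (T : topologicalType) (d : T -> T -> R) x e :
  complete_compatible_metric d -> open [set y | d x y < e].
Proof.
move=> [_ _ dT dN _]; rewrite openE => y /= xy.
apply/dN; exists (e - d x y); first by rewrite subr_gt0.
by move=> z /=; rewrite ltrBrDl; apply: le_lt_trans; exact: dT.
Qed.

(** The balls of radius [1/(n+1)] centred in the dense set form a base: a point [q] of that set
    within [1/(n+1) < e/2] of [x] gives a ball that contains [x] and lies in the [e]-ball around
    [x]. *)
Lemma polish_second_countable (R : realType) (T : topologicalType) :
  polish R T -> @second_countable T.
Proof.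
move=> [[D cD dD] [d dP]].
have [d0 dC dT dN _] := dP.
pose b (p : T * nat) := [set y | d p.1 y < p.2.+1%:R^-1].
exists (b @` (D `*` setT)).
  by apply: (sub_countable (card_image_le _ _)); apply: countableX => //; exact: countableP.
split=> [_ [p _ <-]|x A /dN[e e0 eA]]; first exact: mball_open.
have [n ne] : exists n : nat, n.+1%:R^-1 < e / 2.
  have /ltr_add_invr[n] : 0 < e / 2 by rewrite divr_gt0.
  by rewrite add0r => ?; exists n.
have [q [/= qx qD]] : [set y | d x y < n.+1%:R^-1] `&` D !=set0.
  apply: dD; last exact: mball_open.
  by exists x => /=; rewrite (d0 x x).2// invr_gt0.
exists (b (q, n)); first by split; [exists (q, n)|rewrite /b/= dC].
move=> y /= qy; apply: eA => /=; apply: (le_lt_trans (dT x q y)).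
by rewrite (splitr e) ltrD// (lt_trans _ ne).
Qed.

Lemma second_countable_prod (X Y : topologicalType) :
  @second_countable X -> @second_countable Y -> @second_countable (X * Y)%type.
Proof.
move=> [B cB [Bo Bb]] [C cC [Co Cb]].
exists ((fun p => p.1 `*` p.2) @` (B `*` C)).
  by apply: (sub_countable (card_image_le _ _)); exact: countableX.
split=> [_ [[U V] [/= /Bo Uo /Co Vo] <-]|[x y] A].
  rewrite openE => -[u v] [/= Uu Vv]; exists (U, V) => //=.
  by split; apply: open_nbhs_nbhs.
move=> [[U V] [/= /Bb[U' [BU U'x] U'U] /Cb[V' [CV V'x] V'V]] UVA].
exists (U' `*` V'); first by split=> //; exists (U', V').
by move=> [u v] [/= /U'U uU /V'V vV]; apply: UVA.
Qed.

(** Because of this, measurability and equality of measures for the Borel sets of a product need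
    only be checked on rectangles. *)
Lemma open_prod_bigcup (X Y : topologicalType) (W : set (X * Y)) :
  @second_countable X -> @second_countable Y -> open W ->
  exists F : (set X)^nat, exists G : (set Y)^nat,
    [/\ forall n, open (F n), forall n, open (G n)
      & W = \bigcup_n (F n `*` G n)].
Proof.
move=> [B cB [Bo Bb]] [C cC [Co Cb]] Wo.
pose K := [set p : set X * set Y | [/\ B p.1, C p.2 & p.1 `*` p.2 `<=` W]].
have cK : countable K.
  by apply: (sub_countable _ (countableX cB cC)); apply: subset_card_le => p [].
have /pfcard_geP[K0|[f]] := cK.
  (* An empty [K] has no enumeration by [nat]; then [W] is empty, since each of its points puts a
     rectangle of basic open sets in [K]. *)
  exists (fun=> set0), (fun=> set0); split; do ?by move=> _; exact: open0.
  rewrite bigcup_const; last by exists 0%N.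
  rewrite set0X -subset0 => -[x y] Wxy.
  have [[U V] [/= Ux Vy] UVA] := open_nbhs_nbhs (conj Wo Wxy).
  have [U' [BU U'x] U'U] := Bb _ _ Ux; have [V' [CV V'x] V'V] := Cb _ _ Vy.
  suff : K (U', V') by rewrite K0.
  by split=> // -[u v] [/= /U'U uU /V'V vV]; apply: UVA.
have fK n : K (f n) by exact: funS.
exists (fun n => (f n).1), (fun n => (f n).2); split=> [n|n|].
- by have [/Bo] := fK n.
- by have [_ /Co] := fK n.
- apply/seteqP; split=> [[x y] Wxy|[x y] [n _ Fxy]]; last first.
    by have [_ _] := fK n; apply.
  have [[U V] [/= Ux Vy] UVA] := open_nbhs_nbhs (conj Wo Wxy).
  have [U' [BU U'x] U'U] := Bb _ _ Ux; have [V' [CV V'x] V'V] := Cb _ _ Vy.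
  have /(@surj _ _ _ _ f)[n _ fn] : K (U', V').
    by split=> // -[u v] [/= /U'U uU /V'V vV]; apply: UVA.
  by exists n => //; rewrite fn.
Qed.

Lemma measurable_borel_pair d (T : measurableType d) (X Y : ptopologicalType)
    (f : T -> X) (g : T -> Y) :
  @second_countable X -> @second_countable Y ->
  measurable_fun setT (f : T -> borel X) ->
  measurable_fun setT (g : T -> borel Y) ->
  measurable_fun setT ((fun t => (f t, g t)) : T -> borel (X * Y)%type).
Proof.
move=> cX cY mf mg.
apply: (@measurability _ _ _ (borel (X * Y)%type) _ _ (@open (X * Y)%type)) => //.
move=> _ [W oW <-]; rewrite setTI.
have [F [G [oF oG ->]]] := open_prod_bigcup cX cY oW.
rewrite preimage_bigcup; apply: bigcupT_measurable => n.
rewrite [X in measurable X](_ : _ = f @^-1` F n `&` g @^-1` G n)//.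
apply: measurableI; rewrite -[X in measurable X]setTI.
  by apply: mf => //; exact: sub_sigma_algebra.
by apply: mg => //; exact: sub_sigma_algebra.
Qed.

Lemma continuous_borel_measurable (X Y : ptopologicalType) (f : X -> Y) :
  continuous f -> measurable_fun setT (f : borel X -> borel Y).
Proof.
move=> /continuousP cf; apply: (@measurability _ _ (borel X) (borel Y) _ _ (@open Y)) => //.
by move=> _ [W oW <-]; rewrite setTI; apply: sub_sigma_algebra; exact: cf.
Qed.

(** Measurable rectangles are stable under intersection and, by second countability, generate the
    Borel sets of the product; finite measures that agree on such a class are equal. *)
Lemma borel_prod_measure_eq (R : realType) (X Y : ptopologicalType)
    (m1 m2 : {measure set borel (X * Y)%type -> \bar R}) :
  @second_countable X -> @second_countable Y ->
  (m1 setT < +oo)%E ->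
  (forall (A : set (borel X)) (B : set (borel Y)), measurable A ->
    measurable B -> m1 (A `*` B) = m2 (A `*` B)) ->
  forall C : set (borel (X * Y)%type), measurable C -> m1 C = m2 C.
Proof.
move=> cX cY m1T m12 C mC.
pose G := [set U : set (X * Y) | exists A : set (borel X),
  exists B : set (borel Y), [/\ measurable A, measurable B & U = A `*` B]].
have GT : G setT.
  by exists setT, setT; split=> //; rewrite -setXTT.
apply: (@measure_unique _ R (borel (X * Y)%type) G (fun=> setT)) => //.
- apply/seteqP; split; apply: smallest_sub.
  + exact: smallest_sigma_algebra.
  + move=> W oW; have [F [H [oF oH ->]]] := open_prod_bigcup cX cY oW.
    apply: sigma_algebra_bigcup => n; apply: sub_sigma_algebra.
    by exists (F n), (H n); split=> //; exact: sub_sigma_algebra.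
  + exact: sigma_algebra_measurable.
  + move=> _ [A [B [mA mB ->]]].
    have -> : A `*` B = (fst : X * Y -> X) @^-1` A `&`
                        (snd : X * Y -> Y) @^-1` B by [].
    apply: measurableI; rewrite -[X in measurable X]setTI.
      apply: (@continuous_borel_measurable (X * Y)%type X fst) => // ?.
      exact: cvg_fst.
    apply: (@continuous_borel_measurable (X * Y)%type Y snd) => // ?.
    exact: cvg_snd.
- move=> _ _ [A [B [mA mB ->]]] [A' [B' [mA' mB' ->]]].
  exists (A `&` A'), (B `&` B'); split; do ?exact: measurableI.
  by rewrite setXI.
- by rewrite bigcup_const//; exists 0%N.
- by move=> _ [A [B [mA mB ->]]]; exact: m12.
Qed.

(** * Regularity and tightness of finite Borel measures on Polish spaces *)

Lemma measure_setD_bigcup_lt d (T : measurableType d) (R : realType)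
    (lam : {measure set T -> \bar R}) (U : set T) (F : (set T)^nat) (e : \bar R) :
  (lam setT < +oo)%E -> measurable U -> (forall i, measurable (F i)) ->
  (lam (U `\` \bigcup_i F i) < e)%E ->
  exists N, (lam (U `\` \bigcup_(i in `I_N) F i) < e)%E.
Proof.
move=> lamT mU mF lame.
pose G N := U `\` \bigcup_(i in `I_N) F i.
have mG N : measurable (G N) by apply: measurableD => //; exact: bigcup_measurable.
have GE : U `\` \bigcup_i F i = \bigcap_N G N.
  apply/seteqP; split=> [x [Ux Fx] N _|x Gx].
    by split=> // -[i _ Fix]; apply: Fx; exists i.
  split=> [|[i _ Fix]]; first by have [] := Gx 0%N Logic.I.
  by have [_] := Gx i.+1 Logic.I; apply; exists i => /=.
have : lam \o G @ \oo --> lam (\bigcap_N G N).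
  apply: nonincreasing_cvg_mu => //.
  - by apply: (le_lt_trans _ lamT); apply: le_measure; rewrite ?inE;
      [exact: mG|exact: measurableT|].
  - by apply: bigcapT_measurable => n; exact: mG.
  - move=> m n mn; apply/subsetPset => x [Ux Fx]; split=> // -[i /= im Fix].
    by apply: Fx; exists i => //=; exact: leq_trans mn.
rewrite -GE => /(_ [set y | y < e]%E) [|N _ /(_ N (leqnn N))]; last by exists N.
by apply: open_nbhs_nbhs; split => //; exact: open_ereal_lt_ereal.
Qed.

Lemma measure_bigcup_le_eps d (T : measurableType d) (R : realType)
    (lam : {measure set T -> \bar R}) (B : (set T)^nat) (e : R) :
  0 <= e -> (forall i, measurable (B i)) ->
  (forall i, lam (B i) <= (e / (2 ^ i.+1)%:R)%:E)%E ->
  (lam (\bigcup_i B i) <= e%:E)%E.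
Proof.
move=> e0 mB lamB; apply: (le_trans _ (epsilon_trick0 xpredT e0)).
apply: (@le_trans _ _ (\sum_(i <oo) lam (B i))%E); last exact: lee_nneseries.
by apply: measure_sigma_subadditive => //; exact: bigcupT_measurable.
Qed.

Section polish_regularity.
Context (R : realType) (T : ptopologicalType) (d : T -> T -> R).
Hypothesis dP : complete_compatible_metric d.
Variable lam : {measure set (borel T) -> \bar R}.
Hypothesis lamT : (lam setT < +oo)%E.

Let open_measurable (U : set (borel T)) : open (U : set T) -> measurable U.
Proof. exact: sub_sigma_algebra. Qed.

Let closed_measurable (F : set (borel T)) : closed (F : set T) -> measurable F.
Proof.
move=> cF; rewrite -[F]setCK; apply: measurableC.
by apply: open_measurable; rewrite openC.
Qed.

(** Asking for the closed and the open approximation at once makes the property stable under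
    complements. *)
Let regular (A : set (borel T)) := forall e : R, 0 < e ->
  exists F : set (borel T), exists U : set (borel T),
  [/\ closed (F : set T), open (U : set T), F `<=` A, A `<=` U
    & (lam (U `\` F) < e%:E)%E].

Let open_regular (A : set (borel T)) : open (A : set T) -> regular A.
Proof.
move=> oA e e0; have [d0 dC dT dN _] := dP.
(* [V n] is the open [1/(n+1)]-neighbourhood of the complement of [A]; as [A] is open, the closed
   sets [F n] exhaust it. *)
pose V n : set T := \bigcup_(y in ~` A) [set z | d y z < n.+1%:R^-1].
have oV n : open (V n) by apply: bigcup_open => y _; exact: mball_open.
pose F n : set (borel T) := ~` V n.
have cF n : closed (F n : set T) by rewrite closedC.
have FA n : F n `<=` A.
  move=> x Vx; apply: contrapT => Ax; apply: Vx; exists x => //=.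
  by rewrite (d0 x x).2// invr_gt0.
have : (lam (A `\` \bigcup_n F n) < e%:E)%E.
  rewrite (_ : _ `\` _ = set0) ?measure0 ?lte_fin//.
  rewrite -subset0 => x [Ax]; apply.
  have /dN[r r0 rA] := open_nbhs_nbhs (conj oA Ax).
  have /ltr_add_invr[n] := r0; rewrite add0r => nr.
  exists n => // -[y Ay /= yx]; apply: Ay; apply: rA => /=.
  by rewrite dC (lt_trans yx).
move=> /measure_setD_bigcup_lt[//||n|N lamN]; first exact: open_measurable.
  exact: closed_measurable.
exists (\bigcup_(i in `I_N) F i), A; split=> //.
- exact: closed_bigcup.
- by move=> x [i _ /FA].
Qed.

Let regularC A : regular A -> regular (~` A).
Proof.
move=> rA e e0; have [F [U [cF oU FA AU lamFU]]] := rA e e0.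
exists (~` U), (~` F); split.
- by rewrite closedC.
- by rewrite openC.
- exact: subsetC.
- exact: subsetC.
- by rewrite setDE setCK setIC -setDE.
Qed.

(** The approximations cost [e/2] in total. The union of all [F n] need not be closed, so only
    finitely many are kept; the strict inequality leaves room for that. *)
Let regular_bigcup (A : (set (borel T))^nat) :
  (forall n, regular (A n)) -> regular (\bigcup_n A n).
Proof.
move=> rA e e0.
have e20 : 0 < e / 2 by rewrite divr_gt0.
have e2n n : 0 < e / 2 / (2 ^ n.+1)%:R by rewrite divr_gt0// ltr0n expn_gt0.
have /choice[F /choice[U FU]] n := rA n _ (e2n n).
have cF n : closed (F n : set T) by have [] := FU n.
have oU n : open (U n : set T) by have [] := FU n.
have FA n : F n `<=` A n by have [] := FU n.
have AU n : A n `<=` U n by have [] := FU n.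
have oUU : open (\bigcup_n U n : set T) by apply: bigcup_open => n _.
have : (lam (\bigcup_n U n `\` \bigcup_n F n) < e%:E)%E.
  apply: (@le_lt_trans _ _ (e / 2)%:E); last by rewrite lte_fin; lra.
  apply: (@le_trans _ _ (lam (\bigcup_n (U n `\` F n)))).
    apply: le_measure; rewrite ?inE.
    - apply: measurableD; apply: bigcupT_measurable => n.
        exact: open_measurable.
      exact: closed_measurable.
    - apply: bigcupT_measurable => n; apply: measurableD.
        exact: open_measurable.
      exact: closed_measurable.
    - by move=> x [[n _ Unx] Fx]; exists n => //; split=> // Fnx; apply: Fx; exists n.
  apply: measure_bigcup_le_eps; first exact: ltW.
  - by move=> n; apply: measurableD; [exact: open_measurable|exact: closed_measurable].
  - by move=> n; apply: ltW; have [] := FU n.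
move=> /measure_setD_bigcup_lt[//||n|N lamN]; first exact: open_measurable.
  exact: closed_measurable.
exists (\bigcup_(i in `I_N) F i), (\bigcup_n U n); split=> //.
- exact: closed_bigcup.
- by move=> x [i _ /FA Ax]; exists i.
- by move=> x [i _ /AU Ux]; exists i.
Qed.

Lemma borel_regular (A : set (borel T)) : measurable A -> regular A.
Proof.
move: A; apply: smallest_sub; last exact: open_regular.
split.
- by apply: open_regular; exact: open0.
- by move=> A; rewrite setTD; exact: regularC.
- exact: regular_bigcup.
Qed.

Let cball q r := [set y : T | d q y <= r].

Let closed_cball q r : closed (cball q r).
Proof.
have [_ _ dT dN _] := dP.
rewrite -openC openE => y /= /negP; rewrite -ltNge => ry.
apply/dN; exists (d q y - r); first by rewrite subr_gt0.
move=> z /=; have [_ dC _ _ _] := dP.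
have := dT q z y; rewrite (dC z y) => qy yz; apply/negP; rewrite -ltNge.
by rewrite -(ltrD2r (d y z)) (lt_le_trans _ qy)// addrC -ltrBrDr.
Qed.

(** The set is closed and, for every [k], covered by finitely many balls of radius [1/(k+1)], hence
    compact by completeness: every ultrafilter containing it converges to one of its points. *)
Lemma compact_bigcap_cball (q : nat -> T) (N : nat -> nat) :
  compact (\bigcap_k \bigcup_(j in `I_(N k)) cball (q j) k.+1%:R^-1).
Proof.
set K := (X in compact X).
have cK : closed K.
  by apply: closed_bigI => k _; apply: closed_bigcup => // j _; exact: closed_cball.
rewrite compact_ultra => F UF FK.
(* An ultrafilter that contains a finite union contains one of its members. *)
have FN k : exists j, F (cball (q j) k.+1%:R^-1).
  have : F (\bigcup_(j in `I_(N k)) cball (q j) k.+1%:R^-1).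
    by apply: filterS FK => x /(_ k Logic.I).
  elim: (N k) => [|n IH].
    by rewrite II0 bigcup_set0 => /filter_not_empty.
  rewrite IIS bigcup_setU bigcup_set1 => FU.
  have [|FC] := in_ultra_setVsetC (cball (q n) k.+1%:R^-1) UF; first by exists n.
  apply: IH; apply: filterS (filterI FU FC) => x [[//|]].
  by move=> + /(_ _).
have {FN} /choice[j Fj] := FN.
have [d0 dC dT dN dcomp] := dP.
(* Two balls of the ultrafilter meet, so the distance of their centres is at most the sum of the
   radii: the chosen centres form a Cauchy sequence. *)
have [e e0|l ul] := dcomp (q \o j).
  have /ltr_add_invr[n] : 0 < e / 2 by rewrite divr_gt0.
  rewrite add0r => ne; exists n => k m nk nm /=.
  have [x [/= kx mx]] := filter_ex (filterI (Fj k) (Fj m)).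
  have le_inv p : (n <= p)%N -> p.+1%:R^-1 <= n.+1%:R^-1 :> R.
    by move=> np; rewrite lef_pV2 ?posrE// ler_nat.
  have := dT (q (j k)) x (q (j m)); rewrite (dC x).
  move: kx mx (le_inv _ nk) (le_inv _ nm) ne; rewrite /cball/=.
  move: k.+1%:R^-1 m.+1%:R^-1 n.+1%:R^-1 => u v w ? ? ? ? ? ?; lra.
have Fl : F --> l.
  move=> A /dN[e e0 eA].
  have /ltr_add_invr[n] : 0 < e / 2 by rewrite divr_gt0.
  rewrite add0r => ne.
  have : nbhs l [set y | d l y < e / 2] by apply/dN; exists (e / 2); rewrite ?divr_gt0.
  move=> /ul[m _ /= ml].
  pose p := maxn n m.
  apply: filterS (Fj p) => x /= px; apply: eA => /=.
  have := ml p (leq_maxr _ _); have := dT l (q (j p)) x => /=.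
  have : p.+1%:R^-1 <= n.+1%:R^-1 :> R by rewrite lef_pV2 ?posrE// ler_nat ltnS leq_maxl.
  move: px ne; rewrite /cball/=.
  by move: n.+1%:R^-1 p.+1%:R^-1 => u v ? ? ? ? ?; lra.
exists l; split => //; apply: cK => B lB.
by have [x [Kx Bx]] := filter_ex (filterI FK (Fl _ lB)); exists x.
Qed.

Hypothesis sepT : exists2 D : set T, countable D & dense D.

(** Ulam's theorem. For every [k], finitely many balls of radius [1/(k+1)] around a dense sequence
    leave out less than [e / 2^(k+1)]; the intersection over [k] of these finite unions is
    compact. *)
Lemma borel_tight (e : R) : 0 < e ->
  exists K : set (borel T), [/\ compact (K : set T), closed (K : set T)
    & (lam (~` K) <= e%:E)%E].
Proof.
move=> e0; have [D cD dD] := sepT.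
have [D0|[q]] := (pfcard_geP cD); first by move: dD; rewrite D0 => /dense0.
have qD k : \bigcup_j cball (q j) k.+1%:R^-1 = setT.
  rewrite -subTset => x _.
  have [||y [/= xy /(@surj _ _ _ _ q)[j _ jy]]] := dD [set y | d x y < k.+1%:R^-1].
  - by exists x => /=; have [d0 _ _ _ _] := dP; rewrite (d0 x x).2// invr_gt0.
  - exact: mball_open.
  - by exists j => //=; have [_ dC _ _ _] := dP; rewrite /cball/= jy dC ltW.
have e2n n : 0 < e / (2 ^ n.+1)%:R by rewrite divr_gt0// ltr0n expn_gt0.
have mcb j k : measurable (cball (q j) k.+1%:R^-1 : set (borel T)).
  by apply: closed_measurable; exact: closed_cball.
have /choice[N lamN] k : exists N,
    (lam (setT `\` \bigcup_(j in `I_N) cball (q j) (k.+1%:R^-1)%R) <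
     (e / (2 ^ k.+1)%:R)%:E)%E.
  apply: (@measure_setD_bigcup_lt _ (borel T)) => //.
  by rewrite (qD k) setDv measure0 lte_fin.
exists (\bigcap_k \bigcup_(j in `I_(N k)) cball (q j) k.+1%:R^-1); split.
- exact: compact_bigcap_cball.
- by apply: closed_bigI => k _; apply: closed_bigcup => // j _; exact: closed_cball.
- rewrite setC_bigcap; apply: (@measure_bigcup_le_eps _ (borel T)); first exact: ltW.
    by move=> k; apply: measurableC; apply: bigcup_measurable.
  by move=> k; rewrite -setTD ltW.
Qed.

End polish_regularity.

(** The compact set is the closed inner approximation intersected with Ulam's compact set, each at a
    cost of [e/2]. *)
Lemma polish_compact_open_approx (R : realType) (T : ptopologicalType)
    (lam : {measure set (borel T) -> \bar R}) (A : set (borel T)) (e : R) :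
  polish R T -> (lam setT < +oo)%E -> measurable A -> 0 < e ->
  exists K : set (borel T), exists U : set (borel T),
  [/\ compact (K : set T) /\ measurable K, open (U : set T), K `<=` A, A `<=` U &
    (lam (A `\` K) <= e%:E /\ lam (U `\` A) <= e%:E)%E].
Proof.
move=> [sT [d dP]] lamT mA e0.
have e20 : 0 < e / 2 by rewrite divr_gt0.
have [F [U [cF oU FA AU lamUF]]] := borel_regular dP lamT mA e20.
have [K [kK cK lamK]] := borel_tight dP lamT sT e20.
have mcl (C : set (borel T)) : closed (C : set T) -> measurable C.
  move=> cC; rewrite -[C]setCK; apply: measurableC.
  by apply: sub_sigma_algebra; rewrite openC.
have mF := mcl _ cF; have mK := mcl _ cK.
have mU : measurable U by exact: sub_sigma_algebra.
exists (K `&` F), U; split=> //.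
- split; last exact: measurableI.
  by apply: (subclosed_compact _ kK) => //; exact: closedI.
- by move=> x [_ /FA].
split; last first.
  apply: (@le_trans _ _ (lam (U `\` F))).
    apply: le_measure; rewrite ?inE; do ?exact: measurableD.
    by move=> x [Ux Ax]; split=> // /FA.
  by apply: (le_trans (ltW lamUF)); rewrite lee_fin; lra.
rewrite (splitr e) EFinD; apply: (@le_trans _ _ (lam (~` K) + lam (U `\` F))%E).
  apply: (@le_trans _ _ (lam (~` K `|` (U `\` F)))).
    apply: le_measure; rewrite ?inE.
    - by apply: measurableD => //; exact: measurableI.
    - by apply: measurableU; [exact: measurableC|exact: measurableD].
    - move=> x [Ax KFx]; have [Kx|Kx] := pselect (K x); last by left.
      by right; split; [exact: AU|move=> Fx; exact: KFx].
  by apply: measureU2; [exact: measurableC|exact: measurableD].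
by apply: leeD => //; exact: ltW.
Qed.

(** * Conditional probabilities as Radon-Nikodym densities *)

Lemma ge0_integral_mrestr d (T : measurableType d) (R : realType)
    (mu : {measure set T -> \bar R}) (E D : set T) (mE : measurable E)
    (f : T -> \bar R) :
  measurable D -> measurable_fun D f -> (forall x, D x -> 0 <= f x)%E ->
  (\int[mrestr mu mE]_(x in D) f x = \int[mu]_(x in D `&` E) f x)%E.
Proof.
move=> mD mf f0.
rewrite [LHS](@ge0_negligible_integral _ _ _ _ _ (~` E))//; last 2 first.
- exact: measurableC.
- by rewrite /= /mrestr setICl measure0.
rewrite setDE setCK; apply: eq_measure_integral => A mA AE.
by rewrite /= /mrestr setIidl// => x /AE[].
Qed.

Section image_finite_measure.
Context d d' (T1 : measurableType d) (T2 : measurableType d') (R : realType).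
Variables (m : {finite_measure set T1 -> \bar R}) (X : {mfun T1 >-> T2}).

(** The pushforward under a name that carries a finite measure structure, the form in which it has a
    Radon-Nikodym density below. *)
Definition image_measure : set T2 -> \bar R := fun A => m (X @^-1` A).

Let image0 : image_measure set0 = 0%E.
Proof. by rewrite /image_measure preimage_set0 measure0. Qed.

Let image_ge0 A : (0 <= image_measure A)%E.
Proof. exact: measure_ge0. Qed.

Let image_sigma_additive : semi_sigma_additive image_measure.
Proof. exact: (@measure_semi_sigma_additive _ _ _ (pushforward m X)). Qed.

HB.instance Definition _ := isMeasure.Build _ _ _ image_measure
  image0 image_ge0 image_sigma_additive.

Let image_fin : fin_num_fun image_measure.
Proof.
move=> A mA; apply: fin_num_measure.
by rewrite -[X in measurable X]setTI; exact: measurable_funP.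
Qed.

HB.instance Definition _ :=
  Measure_isFinite.Build _ _ _ image_measure image_fin.

End image_finite_measure.

Section conditional_probability.
Local Open Scope ereal_scope.
Context {R : realType} {d d' : measure_display} {Omega : measurableType d}.
Context {T : measurableType d'} (P : probability Omega R) (zeta : Omega -> T).
Hypothesis mzeta : measurable_fun setT zeta.

(* [h \o zeta] is a version of [P(E | zeta)]; [phi] is arbitrary, and not just
   [1], in order to integrate other conditional probabilities against it. *)
Definition cond_version (E : set Omega) (h : T -> R) :=
  [/\ forall z, (0 <= h z)%R, measurable_fun setT h
    & forall (C : set T) (phi : T -> \bar R), measurable C ->
        (forall z, 0 <= phi z) -> measurable_fun setT phi ->
        \int[P]_(w in E `&` zeta @^-1` C) phi (zeta w) =
        \int[P]_(w in zeta @^-1` C) (phi (zeta w) * (h (zeta w))%:E)].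

Lemma measurable_preimage (C : set T) : measurable C -> measurable (zeta @^-1` C).
Proof. by move=> mC; rewrite -[X in measurable X]setTI; exact: mzeta. Qed.

(** The function [h] is the density of the law of [zeta] under [P] restricted to [E] with respect to
    the law of [zeta] under [P]. *)
Lemma cond_version_exists (E : set Omega) : measurable E ->
  exists h, cond_version E h.
Proof.
move=> mE.
pose Z : {mfun Omega >-> T} := HB.pack zeta (isMeasurableFun.Build _ _ _ _ _ mzeta).
pose nu := image_measure (mrestr P mE) Z.
pose mu := distribution P Z.
have numu : nu `<< mu.
  apply/null_content_dominatesP => A mA.
  rewrite /= /mu /distribution /nu /image_measure /pushforward /mrestr => PA0.
  apply/eqP; rewrite -measure_le0 -[leRHS]PA0; apply: le_measure; rewrite ?inE//.
    by apply: measurableI => //; exact: measurable_preimage.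
  exact: measurable_preimage.
pose f := Radon_Nikodym_SigmaFinite.f nu mu.
have f_ge0 := Radon_Nikodym_SigmaFinite.f_ge0 numu.
have f_fin := Radon_Nikodym_SigmaFinite.f_fin_num numu.
have mf : measurable_fun setT f.
  exact: measurable_int (Radon_Nikodym_SigmaFinite.f_integrable numu).
exists (fine \o f); split.
- by move=> z; apply: fine_ge0; exact: f_ge0.
- exact: measurableT_comp.
- move=> C phi mC phi0 mphi.
  have mzC := measurable_preimage mC.
  have mphiC : measurable_fun C phi by exact: measurable_funTS.
  have := Radon_Nikodym_SigmaFinite.change_of_variables numu phi0 mC mphiC.
  rewrite (@ge0_integral_pushforward _ _ _ _ _ _ mzeta P)//; last 2 first.
    by apply: emeasurable_funM => //; exact: measurable_funTS.
    by move=> z _; apply: mule_ge0 => //; exact: f_ge0.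
  rewrite (@ge0_integral_pushforward _ _ _ _ _ _ mzeta (mrestr P mE))//.
  have mphiz : measurable_fun (zeta @^-1` C) (phi \o zeta).
    by apply: measurable_funTS; exact: measurableT_comp.
  rewrite (ge0_integral_mrestr P mE mzC mphiz); last by move=> w _ /=.
  rewrite setIC => <-; apply: eq_integral => w _ /=.
  by rewrite fineK//; exact: f_fin.
Qed.

Lemma cond_version_integral E h (C : set T) : measurable E -> cond_version E h ->
  measurable C ->
  \int[P]_(w in zeta @^-1` C) (h (zeta w))%:E = P (E `&` zeta @^-1` C).
Proof.
move=> mE [h0 mh hE] mC.
have := hE C (cst 1) mC (fun=> lee01) (measurable_cst _).
rewrite integral_cst/= ?mul1e; last first.
  by apply: measurableI => //; exact: measurable_preimage.
by move=> ->; apply: eq_integral => w _; rewrite mul1e.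
Qed.

(** The integral identity is a hypothesis, in place of [cond_version], so that the lemma also
    applies to the product of two versions. *)
Lemma cond_prob_of_version E h (f : Omega -> R) :
  measurable E -> (forall w, 0 <= f w)%R -> measurable_fun setT h -> f = h \o zeta ->
  (forall C, measurable C ->
     \int[P]_(w in zeta @^-1` C) (f w)%:E = P (E `&` zeta @^-1` C)) ->
  is_cond_prob P zeta E f.
Proof.
move=> mE f0 mh fh fE; split.
- move=> _ B mB; rewrite setTI fh; exists (h @^-1` B); last by rewrite setTI.
  by rewrite -[X in measurable X]setTI; exact: mh.
- apply/integrableP; split.
    by apply/measurable_EFinP; rewrite fh; exact: measurableT_comp.
  under eq_integral do rewrite gee0_abs ?lee_fin//=.
  have := fE setT measurableT; rewrite preimage_setT setIT => ->.
  by rewrite -ge0_fin_numE// fin_num_measure.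
- by move=> _ [C mC <-]; rewrite setTI; exact: fE.
Qed.

End conditional_probability.

(** * The semiring of rectangles and finite additivity of bimeasures *)

Section rectangles.
Context d1 d2 (T1 : measurableType d1) (T2 : measurableType d2).

(** A copy of the product type, to carry the semiring of rectangles instead of the product
    sigma-algebra. *)
Definition rect_type := (T1 * T2)%type.

Definition rect_display : Type -> measure_display. Proof. exact. Qed.

Definition is_rect : set (set rect_type) :=
  [set A `*` B | A in @measurable d1 T1 & B in @measurable d2 T2].

Let is_rect0 : is_rect set0.
Proof.
exists set0; first exact: measurable0.
by exists set0; [exact: measurable0|rewrite setX0].
Qed.

Let is_rectI : setI_closed is_rect.
Proof.
move=> _ _ [A mA [B mB <-]] [A' mA' [B' mB' <-]].
exists (A `&` A'); first exact: measurableI.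
by exists (B `&` B'); [exact: measurableI|rewrite setXI].
Qed.

Let is_rectD : semi_setD_closed is_rect.
Proof.
move=> _ _ [A mA [B mB <-]] [A' mA' [B' mB' <-]].
exists [set (A `\` A') `*` B; (A `&` A') `*` (B `\` B')]; split.
- exact: finite_set2.
- move=> _ [->|->].
    by exists (A `\` A'); [exact: measurableD|exists B].
  exists (A `&` A'); first exact: measurableI.
  by exists (B `\` B'); [exact: measurableD|].
- rewrite bigcup_setU !bigcup_set1; apply/seteqP; split=> [[x y]|[x y]] /=.
    move=> [[Ax By] AB']; have [A'x|A'x] := pselect (A' x); last by left.
    by right; split=> //; split=> // B'y; exact: AB'.
  by move=> [[[Ax A'x] By]|[[Ax A'x] [By B'y]]]; split=> // -[].
- move=> _ _ [->|->] [->|->] [[x y] /=] => // -[].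
    by move=> [[? nA'x] _] [[_ /nA'x]].
  by move=> [[_ A'x] _] [[_ /(_ A'x)]].
Qed.

HB.instance Definition _ := Pointed.on rect_type.
HB.instance Definition _ := @isSemiRingOfSets.Build (rect_display (T1 * T2))
  rect_type is_rect is_rect0 is_rectI is_rectD.

End rectangles.

(* A bimeasure need not be the restriction to rectangles of a measure on the
   product. *)
Record bimeasure (R : realType) d1 d2 (T1 : measurableType d1)
    (T2 : measurableType d2) := Bimeasure {
  bml : set T2 -> {measure set T1 -> \bar R} ;
  bmr : set T1 -> {measure set T2 -> \bar R} ;
  bmlr : forall A C, measurable A -> measurable C -> bml C A = bmr A C
}.

Section bimeasure.
Local Open Scope ereal_scope.
Context (R : realType) d1 d2 (T1 : measurableType d1) (T2 : measurableType d2).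
Variable b : bimeasure R T1 T2.
Let bl := bml b.
Let br := bmr b.
Let blr : forall A C, measurable A -> measurable C -> bl C A = br A C :=
  @bmlr _ _ _ _ _ b.

Section atoms.
Variables (I : finType) (A : I -> set T1) (C : I -> set T2).
Hypotheses (mA : forall i, measurable (A i)) (mC : forall i, measurable (C i)).

(** The atoms of the finite algebra generated by the [C i]; some may be empty. *)
Definition atom (J : {set I}) : set T2 := [set y | [set i | y \in C i]%SET = J].

Lemma measurable_atom J : measurable (atom J).
Proof.
have -> : atom J = \bigcap_(i in [set: I]) (if i \in J then C i else ~` C i).
  apply/seteqP; split=> [y <- i _|y yJ].
    by rewrite inE; case: ifPn => [/set_mem//|/negP yC Cy]; apply: yC; exact/mem_set.
  apply/setP => i; rewrite inE; have := yJ i Logic.I.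
  by case: ifPn => [_ /mem_set//|_ Cy]; apply/negP => /set_mem.
rewrite -[X in measurable X]setCK setC_bigcap; apply: measurableC.
apply: fin_bigcup_measurable; first exact: finite_finset.
by move=> i _; apply: measurableC; case: ifPn => // _; exact: measurableC.
Qed.

Lemma indic_atom i y :
  \1_(C i) y = (\sum_(J : {set I}) if i \in J then \1_(atom J) y else 0)%R :> R.
Proof.
rewrite (bigD1 [set i | y \in C i]%SET)// big1 => [|J /eqP yJ].
  rewrite /= addr0 !indicE [y \in atom _]mem_set// finset.inE.
  by case: (y \in C i).
case: ifP => // _; rewrite indicE memNset// => yJ'.
by apply: yJ; rewrite -yJ'.
Qed.

(* On an atom of the partition generated by the [C i], whether [y \in C i] does
   not depend on [y], so that only a measure on [T1] is left. *)
Lemma bimeasure_sum_atoms (p : pred I) :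
  \sum_(i | p i) br (A i) (C i) =
  \sum_(J : {set I}) \int[bl (atom J)]_x
     \sum_(i | p i) (if i \in J then (\1_(A i) x)%:E else 0).
Proof.
have brE i : br (A i) (C i) =
    \sum_(J : {set I}) (if i \in J then bl (atom J) (A i) else 0).
  rewrite -[C i]setIT -integral_indic//.
  under eq_integral do rewrite indic_atom -sumEFin.
  rewrite ge0_integral_sum//.
  - apply: eq_bigr => J _; case: (i \in J); last by rewrite integral0.
    by rewrite integral_indic ?setIT ?blr//; exact: measurable_atom.
  - move=> J; case: (i \in J); last exact: measurable_cst.
    by apply/measurable_EFinP; apply: measurable_indic; exact: measurable_atom.
  - by move=> J y _; case: ifPn => _; rewrite lee_fin.
rewrite (eq_bigr _ (fun i _ => brE i)).
rewrite exchange_big; apply: eq_bigr => J _.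
transitivity (\int[bl (atom J)]_x
    \sum_(i <- enum p) (if i \in J then (\1_(A i) x)%:E else 0)); last first.
  by apply: eq_integral => x _; rewrite big_enum.
rewrite ge0_integral_sum// ?big_enum//=.
- apply: eq_bigr => i _; case: (i \in J); last by rewrite integral0.
  by rewrite integral_indic// setIT.
- move=> i; case: (i \in J); last exact: measurable_cst.
  by apply/measurable_EFinP; apply: measurable_indic.
- by move=> i x _; case: ifPn => _; rewrite lee_fin.
Qed.

(** The hypothesis compares the numbers of rectangles of two families that contain a point. For [y]
    fixed in a nonempty atom, these numbers are the integrands in [bimeasure_sum_atoms]. *)
Lemma bimeasure_le (p q : pred I) :
  (forall x y, \sum_(i | p i) ((x \in A i) && (y \in C i) : nat) <=
     \sum_(i | q i) ((x \in A i) && (y \in C i) : nat))%N ->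
  \sum_(i | p i) br (A i) (C i) <= \sum_(i | q i) br (A i) (C i).
Proof.
move=> pq; rewrite !bimeasure_sum_atoms; apply: lee_sum => J _.
have m r : measurable_fun setT
    (fun x => \sum_(i | r i) (if i \in J then (\1_(A i) x)%:E else 0 : \bar R)).
  under eq_fun do rewrite -big_enum.
  apply: emeasurable_sum => i; case: (i \in J); last exact: measurable_cst.
  by apply/measurable_EFinP; apply: measurable_indic.
have [atom0|/set0P[y Jy]] := eqVneq (atom J) set0.
  (* An empty atom offers no [y] to fix, but its measure on [T1] is zero. *)
  rewrite atom0.
  have bl0 : bl set0 setT = 0 by rewrite blr// measure0.
  by rewrite !null_set_integral.
apply: ge0_le_integral => //.
  by move=> x _; apply: sume_ge0 => i _; case: ifPn => // _; rewrite lee_fin.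
move=> x _.
have sumE r : \sum_(i | r i) (if i \in J then (\1_(A i) x)%:E else 0) =
    (\sum_(i | r i) ((x \in A i) && (y \in C i) : nat))%:R%:E :> \bar R.
  rewrite natr_sum -sumEFin; apply: eq_bigr => i _.
  rewrite -Jy inE indicE andbC; case: (y \in C i) => //=.
by rewrite !sumE lee_fin ler_nat.
Qed.

End atoms.

Section one_rectangle.
Variables (A0 : set T1) (C0 : set T2) (A : nat -> set T1) (C : nat -> set T2).
Hypotheses (mA0 : measurable A0) (mC0 : measurable C0).
Hypotheses (mA : forall i, measurable (A i)) (mC : forall i, measurable (C i)).

(** The single rectangle is put at index 0, in front of the first [n] others, since [bimeasure_le]
    compares two subfamilies of one family. *)
Let A' n (i : 'I_n.+1) := if (i : nat) is k.+1 then A k else A0.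
Let C' n (i : 'I_n.+1) := if (i : nat) is k.+1 then C k else C0.

Let mA' n i : measurable (@A' n i). Proof. by rewrite /A'; case: (i : nat). Qed.
Let mC' n i : measurable (@C' n i). Proof. by rewrite /C'; case: (i : nat). Qed.

Lemma bimeasure_le_sum n :
  (forall x y, (x \in A0) && (y \in C0) <=
     \sum_(i < n) ((x \in A i) && (y \in C i) : nat))%N ->
  br A0 C0 <= \sum_(i < n) br (A i) (C i).
Proof.
move=> le; have := @bimeasure_le _ (@A' n) (@C' n) (@mA' n) (@mC' n)
  (fun i => i == ord0) (fun i => i != ord0).
rewrite [leLHS]big_mkcond [leRHS]big_mkcond !big_ord_recl/= big1 ?adde0// add0e; apply.
move=> x y; rewrite big_mkcond [leqRHS]big_mkcond !big_ord_recl/= big1 ?addn0// add0n.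
Qed.

Lemma bimeasure_ge_sum n :
  (forall x y, \sum_(i < n) ((x \in A i) && (y \in C i) : nat) <=
    (x \in A0) && (y \in C0))%N ->
  \sum_(i < n) br (A i) (C i) <= br A0 C0.
Proof.
move=> le; have := @bimeasure_le _ (@A' n) (@C' n) (@mA' n) (@mC' n)
  (fun i => i != ord0) (fun i => i == ord0).
rewrite [leLHS]big_mkcond [leRHS]big_mkcond !big_ord_recl/= add0e.
rewrite [X in _ + X]big1 ?adde0//; apply.
move=> x y; rewrite big_mkcond [leqRHS]big_mkcond !big_ord_recl/= add0n.
by rewrite [X in (_ <= _ + X)%N]big1 ?addn0.
Qed.

End one_rectangle.

(** Defined on all sets through the two projections, which recover the sides of a nonempty
    rectangle; only the values on rectangles matter. *)
Definition rect_bimeasure (U : set (rect_type T1 T2)) : \bar R :=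
  br (fst @` U) (snd @` U).

Lemma rect_bimeasureE A C : measurable A -> measurable C ->
  rect_bimeasure (A `*` C) = br A C.
Proof.
move=> mA mC; rewrite /rect_bimeasure.
(* Both projections of an empty rectangle are empty, even if one side is not; the two values are
   then 0. *)
have [->|/set0P[x Ax]] := eqVneq A set0.
  by rewrite set0X !image_set0 -!blr ?measure0.
have [->|/set0P[y Cy]] := eqVneq C set0.
  by rewrite setX0 !image_set0 !measure0.
congr (br _ _); apply/seteqP; split=> [_ [[u v] [/= Au Cv] <-]//|u ?].
  by exists (u, y).
by exists (x, u).
Qed.

Let rect_bimeasure_ge0 U : 0 <= rect_bimeasure U.
Proof. exact: measure_ge0. Qed.

Lemma measurable_rectP (F : (set (rect_type T1 T2))^nat) :
  (forall n, measurable (F n)) -> exists (A : (set T1)^nat) (C : (set T2)^nat),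
    [/\ forall n, measurable (A n), forall n, measurable (C n)
      & forall n, F n = A n `*` C n].
Proof.
move=> mF; have /choice[AC ACF] n : exists AC : set T1 * set T2,
    [/\ measurable AC.1, measurable AC.2 & F n = AC.1 `*` AC.2].
  by have [A mA [C mC <-]] := mF n; exists (A, C).
by exists (fun n => (AC n).1), (fun n => (AC n).2); split=> n; have [] := ACF n.
Qed.

(** A point lies in exactly one of the disjoint rectangles if it is in their union and in none
    otherwise, so both comparisons of counts apply. *)
Let rect_bimeasure_semi_additive : measure_function.semi_additive rect_bimeasure.
Proof.
move=> F n mF tF [A0 mA0 [C0 mC0 UF]].
have [A [C [mA mC FAC]]] := measurable_rectP mF.
rewrite -UF rect_bimeasureE//.
rewrite (eq_bigr (fun i : 'I_n => br (A i) (C i))); last first.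
  by move=> i _; rewrite FAC rect_bimeasureE.
have FE x y i : (x \in A i) && (y \in C i) = ((x, y) \in F i).
  apply/andP/idP => [[/set_mem Ax /set_mem Cy]|/set_mem].
    by apply/mem_set; rewrite FAC.
  by rewrite FAC => -[/= Ax Cy]; split; exact/mem_set.
have F0 x y : (x \in A0) && (y \in C0) = ((x, y) \in \big[setU/set0]_(i < n) F i).
  rewrite -UF; apply/andP/idP => [[/set_mem Ax /set_mem Cy]|/set_mem [/= Ax Cy]].
    exact/mem_set.
  by split; exact/mem_set.
have sumE x y : (\sum_(i < n) ((x \in A i) && (y \in C i) : nat) =
    (x \in A0) && (y \in C0) :> nat)%N.
  rewrite F0; case: (boolP (_ \in _)) => [/set_mem|/negP xyF].
    rewrite -bigcup_mkord => -[i /= ni Fi].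
    rewrite (bigD1 (Ordinal ni))//= FE mem_set// big1// => j ji.
    rewrite FE memNset// => Fj; move/eqP: ji; apply; apply/val_inj => /=.
    by apply: (tF _ _ Logic.I Logic.I); exists (x, y).
  apply: big1 => i _; rewrite FE memNset// => Fi; apply: xyF; apply/mem_set.
  by rewrite -bigcup_mkord; exists i => /=.
by apply/eqP; rewrite eq_le bimeasure_le_sum ?bimeasure_ge_sum// => x y; rewrite sumE.
Qed.

HB.instance Definition _ := isContent.Build _ _ _ rect_bimeasure
  rect_bimeasure_ge0 rect_bimeasure_semi_additive.

End bimeasure.

(** * Extension of a bimeasure with a Polish factor to a measure *)

Section polish_bimeasure.
Local Open Scope ereal_scope.
Context (R : realType) (X : ptopologicalType) d2 (T2 : measurableType d2).
Hypothesis pX : polish R X.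
Variable b : bimeasure R (borel X) T2.
Hypothesis bT : bmr b setT setT < +oo.

Let br_le A C A' C' : measurable A -> measurable C -> measurable A' -> measurable C' ->
  A `<=` A' -> C `<=` C' -> bmr b A C <= bmr b A' C'.
Proof.
move=> mA mC mA' mC' AA' CC'; apply: (@le_trans _ _ (bmr b A C')).
  by apply: le_measure; rewrite ?inE.
by rewrite -!bmlr//; apply: le_measure; rewrite ?inE.
Qed.

(** Compactness in [X] makes the cover finite, fibre by fibre. [A0] is shrunk to a compact [K] and
    each [A n] enlarged to an open [U n]. Over each [y] in [C0], finitely many [U i] with [C i y]
    cover [K]; hence the sets [D N] increase to [C0], and over each of them the finite comparison
    holds. *)
Lemma rect_bimeasure_sigma_subadditive :
  measurable_subset_sigma_subadditive (rect_bimeasure b).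
Proof.
move=> _ F mF [A0 mA0 [C0 mC0 <-]] AF.
have [A [C [mA mC FAC]]] := measurable_rectP mF.
rewrite rect_bimeasureE//.
have FE n : rect_bimeasure b (F n) = bmr b (A n) (C n).
  by rewrite FAC rect_bimeasureE.
rewrite (eq_eseriesr (fun i _ => FE i)).
apply/lee_addgt0Pr => e e0.
have e20 : (0 < e / 2)%R by rewrite divr_gt0.
have e2n n : (0 < e / 2 / (2 ^ n.+1)%:R)%R by rewrite divr_gt0// ltr0n expn_gt0.
(* The marginal on [X] bounds [bmr b A C] for every measurable [C], so it controls the errors made
   in the first factor. *)
pose lam := bml b setT.
have lamT : lam setT < +oo by rewrite /lam bmlr.
have [K [_ [[cK mK] _ KA _ [lamK _]]]] := polish_compact_open_approx pX lamT mA0 e20.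
have /choice[U UP] n : exists U : set (borel X), [/\ open (U : set X), A n `<=` U
    & lam (U `\` A n) <= (e / 2 / (2 ^ n.+1)%:R)%:E].
  have [? [U [_ oU _ AU [_ lU]]]] :=
    polish_compact_open_approx pX lamT (mA n) (e2n n).
  by exists U.
have oU n : open (U n : set X) by have [] := UP n.
have mU n : measurable (U n) by apply: sub_sigma_algebra; exact: oU.
(* [D N] is the set of the [y] for which the first [N] rectangles already cover
   the compact fibre [K * {y}]. *)
pose D N := C0 `&` \bigcup_(J in [set J : {set 'I_N} |
  K `<=` \bigcup_(i in [set i | i \in J]) U (val i)])
    \bigcap_(i in [set i | i \in J]) C (val i).
have mD N : measurable (D N).
  apply: measurableI => //; apply: fin_bigcup_measurable; first exact: finite_finset.
  move=> J _; rewrite -[X in measurable X]setCK setC_bigcap; apply: measurableC.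
  by apply: fin_bigcup_measurable; [exact: finite_finset|move=> i _; exact: measurableC].
have DC : \bigcup_N D N = C0.
  apply/seteqP; split=> [y [N _ []]//|y C0y].
  have : compact (K : set X) by [].
  rewrite compact_cover => /(_ nat [set i | C i y] (fun i => U i : set X)).
  case=> [i _|x Kx|J JC KJ]; first exact: oU.
    have : (A0 `*` C0) (x, y) by split => //; exact: KA.
    move=> /AF[i _]; rewrite FAC => -[/= Aix Ciy]; exists i => //.
    by have [_ + _] := UP i; apply.
  pose N := (\max_(i <- finmap.enum_fset J) i).+1.
  have JN i : i \in J -> (i < N)%N.
    by move=> iJ; rewrite /N ltnS; apply: (@leq_bigmax_seq _ (finmap.enum_fset J) xpredT id).
  exists N => //; split=> //; exists [set i : 'I_N | (i : nat) \in J]%SET => /=.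
    move=> x /KJ[i iJ Uix]; exists (Ordinal (JN _ iJ)) => //=.
    by rewrite finset.inE.
  by move=> i /=; rewrite finset.inE => /JC; rewrite inE.
have ndD : {homo D : n m / (n <= m)%N >-> (n <= m)%O}.
  move=> n m nm; apply/subsetPset => y [C0y [J /= KJ JC]]; split=> //.
  exists [set widen_ord nm i | i in J]%SET => /=.
    move=> x /KJ[i /= iJ Ux]; exists (widen_ord nm i) => //=.
    exact: imset_f.
  by move=> i /= /imsetP[j jJ ->] /=; exact: JC.
(* The rectangles with sides [U i] and [C i], [i < N], cover the one with sides [K] and [D N];
   replacing [U i] by [A i] costs at most [e/2] in total. *)
have bKD N : bmr b K (D N) <= \sum_(i <oo) bmr b (A i) (C i) + (e / 2)%:E.
  have KDU : bmr b K (D N) <= \sum_(i < N) bmr b (U i) (C i).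
    apply: bimeasure_le_sum => // x y.
    case: (boolP (_ && _)) => // /andP[/set_mem Kx /set_mem[C0y [J /= KJ JC]]].
    have [i /= iJ Ux] := KJ _ Kx; rewrite (bigD1 i)//=.
    by rewrite mem_set// mem_set//; exact: JC.
  apply: (le_trans KDU).
  apply: (@le_trans _ _ (\sum_(i < N) (bmr b (A i) (C i) + (e / 2 / (2 ^ i.+1)%:R)%:E))).
    apply: lee_sum => i _; have [_ AU lU] := UP i.
    have -> : bmr b (U i) (C i) = bmr b (A i) (C i) + bmr b (U i `\` A i) (C i).
      rewrite -!bmlr//; last exact: measurableD.
      rewrite -measureU//; [|exact: measurableD|by rewrite setDE setIC -setIA setICl setI0].
      by rewrite setDUK.
    apply: leeD => //; apply: le_trans lU; rewrite /lam bmlr//; last exact: measurableD.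
    by apply: br_le => //; exact: measurableD.
  apply: le_trans (epsilon_trick xpredT _ _); last 2 first.
    by move=> n; exact: measure_ge0.
    exact: ltW.
  rewrite -(big_mkord xpredT (fun i => bmr b (A i) (C i) + (e / 2 / (2 ^ i.+1)%:R)%:E)).
  by apply: nneseries_lim_ge => n _ _; rewrite adde_ge0// lee_fin ltW.
(* Continuity from below of [bmr b K] along the sets [D N]. *)
have bKC : bmr b K C0 <= \sum_(i <oo) bmr b (A i) (C i) + (e / 2)%:E.
  have : (bmr b K \o D) @ \oo --> bmr b K C0.
    by rewrite -[in X in _ --> X]DC; apply: nondecreasing_cvg_mu => //; rewrite DC.
  move=> /cvg_lim <-//; apply: lime_le; last by apply: nearW => N; exact: bKD.
  apply: ereal_nondecreasing_is_cvgn => n m nm.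
  by apply: le_measure; rewrite ?inE//; exact/subsetPset/ndD.
(* The other [e/2] pays for passing from [K] back to [A0]. *)
have -> : bmr b A0 C0 = bmr b K C0 + bmr b (A0 `\` K) C0.
  rewrite -!bmlr//; last exact: measurableD.
  rewrite -measureU//; [|exact: measurableD|by rewrite setDE setIC -setIA setICl setI0].
  by rewrite setDUK.
rewrite [in leRHS](splitr e) EFinD addeA; apply: leeD => //.
apply: le_trans lamK; rewrite /lam bmlr//; last exact: measurableD.
by apply: br_le => //; exact: measurableD.
Qed.

(** Countable subadditivity makes the content a measure on the semiring of rectangles, which
    Caratheodory's theorem extends. *)
Theorem bimeasure_extension :
  exists M : {measure set (borel X * T2)%type -> \bar R},
    forall A C, measurable A -> measurable C -> M (A `*` C) = bmr b A C.
Proof.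
pose m : {measure set (rect_type (borel X) T2) -> \bar R} :=
  HB.pack (rect_bimeasure b) (Content_isMeasure.Build _ _ _ (rect_bimeasure b)
    (semiring_sigma_additive rect_bimeasure_sigma_subadditive)).
pose N := measure_extension m.
(* The identity map, from the sigma-algebra generated by the rectangles to the product
   sigma-algebra; the extension is pushed forward along it. *)
pose f : g_sigma_algebraType (@measurable _ (rect_type (borel X) T2)) ->
  (borel X * T2)%type := id.
have mf : measurable_fun setT f.
  by move=> _ A; rewrite setTI measurable_prod_measurableType.
have [M ME] : exists M : {measure set (borel X * T2)%type -> \bar R},
    forall A, M A = N A.
  by unshelve eexists; [exact: (pushforward N f)|].
exists M => A C mA mC; rewrite ME /N /measure_extension measurable_mu_extE/=.
  exact: rect_bimeasureE.
by exists A => //; exists C.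
Qed.

End polish_bimeasure.

(** * Resampling a coordinate from its conditional law *)

Lemma density_measure_exists d (T : measurableType d) (R : realType)
    (mu : {measure set T -> \bar R}) (f : T -> \bar R) :
  measurable_fun setT f -> (forall x, 0 <= f x)%E ->
  exists m : {measure set T -> \bar R}, forall A, (m A = \int[mu]_(x in A) f x)%E.
Proof.
move=> mf f0; pose m A := (\int[mu]_(x in A) f x)%E.
have m0 : m set0 = 0%E by rewrite /m integral_set0.
have m_ge0 A : (0 <= m A)%E by exact: integral_ge0.
pose m' : {measure set T -> \bar R} := HB.pack m (isMeasure.Build _ _ _ m
  m0 m_ge0 (semi_sigma_additive_nng_induced mf f0)).
by exists m'.
Qed.

Lemma pushforward_measure_exists d d' (T : measurableType d)
    (T' : measurableType d') (R : realType) (mu : {measure set T -> \bar R})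
    (f : T -> T') :
  measurable_fun setT f ->
  exists m : {measure set T' -> \bar R}, forall A, m A = mu (f @^-1` A).
Proof. by move=> mf; unshelve eexists; [exact: (pushforward mu f)|]. Qed.

Lemma probability_of_measure d (T : measurableType d) (R : realType)
    (mu : {measure set T -> \bar R}) :
  mu setT = 1%E -> exists P : probability T R, forall A, P A = mu A.
Proof.
(* The Dirac measure is a default for total mass 0 or infinity, not reached here. *)
move=> mu1; exists (mnormalize mu (dirac point)) => A /=.
by rewrite /mnormalize mu1 onee_eq0/= invr1 mule1.
Qed.

Section resampling.
Local Open Scope ereal_scope.
Context (R : realType) d d' (Omega : measurableType d) (T : measurableType d').
Context (X : ptopologicalType) (P : probability Omega R).
Variables (xi : Omega -> borel X) (zeta : Omega -> T).
Hypotheses (pX : polish R X) (mxi : measurable_fun setT xi)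
           (mzeta : measurable_fun setT zeta).

(* Under [M] on [X * Omega], the second coordinate has law [P], and the first
   one is a copy of [xi] drawn from its conditional law given [zeta]
   independently of everything else. *)
Definition resampling (M : probability (borel X * Omega)%type R) :=
  forall (A : set (borel X)) (C : set Omega) g, measurable A -> measurable C ->
    cond_version P zeta (xi @^-1` A) g ->
    M (A `*` C) = \int[P]_(w in C) (g (zeta w))%:E.

(** The integral of [P(xi in A | zeta)] over [C] is a measure in [C]. It equals the integral of
    [P(C | zeta)] over the event [xi in A], a measure in [A], since both are the integral of the
    product of the two conditional probabilities. *)
Lemma resampling_exists : exists M, resampling M.
Proof.
(* The default 0 keeps [dens E] nonnegative and measurable when [E] is not measurable, so that [br]
   and [bl] consist of measures for all sets. *)
pose dens (E : set Omega) : T -> R := xget (cst 0%R) [set h | cond_version P zeta E h].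
have densP E : measurable E -> cond_version P zeta E (dens E).
  move=> /(cond_version_exists P mzeta)[h hE].
  exact: (@xgetPex _ (cst 0%R) [set h | cond_version P zeta E h] (ex_intro _ h hE)).
have dens_ge0_meas E : (forall z, 0 <= dens E z)%R /\ measurable_fun setT (dens E).
  rewrite /dens; case: xgetP => [h _ []//|_].
  by split=> //; exact: measurable_cst.
have mxiA A : measurable A -> measurable (xi @^-1` A).
  by move=> mA; exact: measurable_preimage.
have /choice[br brE] (A : set (borel X)) : exists m : {measure set Omega -> \bar R},
    forall C, m C = \int[P]_(w in C) (dens (xi @^-1` A) (zeta w))%:E.
  have [d0 md] := dens_ge0_meas (xi @^-1` A).
  apply: density_measure_exists => [|w]; last by rewrite lee_fin.
  by apply/measurable_EFinP; exact: measurableT_comp.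
have /choice[bl blE] (C : set Omega) : exists m : {measure set (borel X) -> \bar R},
    forall A, m A = \int[P]_(w in xi @^-1` A) (dens C (zeta w))%:E.
  have [d0 md] := dens_ge0_meas C.
  have [||m mE] := @density_measure_exists _ _ _ P (fun w => (dens C (zeta w))%:E).
  - by apply/measurable_EFinP; exact: measurableT_comp.
  - by move=> w; rewrite lee_fin.
  have [m' m'E] := pushforward_measure_exists m mxi.
  by exists m' => A; rewrite m'E mE.
have fubini (E F : set Omega) g h : measurable E -> measurable F ->
    cond_version P zeta E g -> cond_version P zeta F h ->
    \int[P]_(w in E) (h (zeta w))%:E = \int[P]_(w in F) (g (zeta w))%:E.
  move=> mE mF [g0 mg gE] [h0 mh hF].
  have := gE setT (EFin \o h) measurableT; rewrite preimage_setT setIT => ->; last 2 first.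
  - by move=> z; rewrite lee_fin.
  - exact/measurable_EFinP.
  have := hF setT (EFin \o g) measurableT; rewrite preimage_setT setIT => ->; last 2 first.
  - by move=> z; rewrite lee_fin.
  - exact/measurable_EFinP.
  by apply: eq_integral => w _; rewrite /= muleC.
have blr A C : measurable A -> measurable C -> bl C A = br A C.
  move=> mA mC; rewrite blE brE; apply: fubini => //; do ?exact: mxiA.
    by apply: densP; exact: mxiA.
  exact: densP.
pose b := Bimeasure blr.
have br1 : bmr b setT setT = 1.
  rewrite /b/= brE.
  have := cond_version_integral mzeta measurableT (densP _ measurableT) measurableT.
  by rewrite !preimage_setT setIT probability_setT.
have [|M0 M0E] := bimeasure_extension pX (b := b); first by rewrite br1 ltry.
have [|M ME] := @probability_of_measure _ _ _ M0.
  by rewrite -setXTT M0E.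
exists M => A C g mA mC gA; rewrite ME M0E//=.
(* The version [g] may differ from the chosen one; exchanging the roles once more removes the
   choice. *)
rewrite -blr// blE; apply: fubini => //; first exact: mxiA.
exact: densP.
Qed.

Variable M : probability (borel X * Omega)%type R.
Hypothesis ME : resampling M.

(** The constant 1 is a version of the conditional probability of the whole space. *)
Lemma resampling_snd (C : set Omega) : measurable C -> M (setT `*` C) = P C.
Proof.
move=> mC; have c1 : cond_version P zeta (xi @^-1` setT) (cst 1%R).
  rewrite preimage_setT; split=> // D phi mD phi0 mphi; rewrite setTI.
  by apply: eq_integral => w _; rewrite mule1.
by rewrite (ME measurableT mC c1) (integral_cst P mC 1) mul1e.
Qed.

(** On events of [zeta] this is the defining identity of conditional probability: the copy has the
    same joint law with [zeta] as [xi]. *)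
Lemma resampling_fst (A : set (borel X)) (D : set T) : measurable A -> measurable D ->
  M (A `*` zeta @^-1` D) = P (xi @^-1` A `&` zeta @^-1` D).
Proof.
move=> mA mD.
have mxiA : measurable (xi @^-1` A) by exact: measurable_preimage.
have [g gA] := cond_version_exists P mzeta mxiA.
rewrite (ME mA _ gA); last exact: measurable_preimage.
exact: cond_version_integral.
Qed.

(** For versions [g] of [P(xi in A | zeta)] and [h] of [P(eta in B | zeta)], the hypothesis makes
    the probability of [xi in A], [eta in B], [zeta in D] the integral of [g] over the last two
    events, hence of [g h] over [zeta in D]. So [g h] is a version for the intersection. *)
Lemma resampling_cond_independent d2 (T2 : measurableType d2) (eta : Omega -> T2) :
  measurable_fun setT eta ->
  (forall (A : set (borel X)) B D, measurable A -> measurable B -> measurable D ->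
    P (xi @^-1` A `&` (eta @^-1` B `&` zeta @^-1` D)) =
    M (A `*` (eta @^-1` B `&` zeta @^-1` D))) ->
  cond_independent P xi eta zeta.
Proof.
move=> meta PM A B mA mB.
have mxiA : measurable (xi @^-1` A) by exact: measurable_preimage.
have metaB : measurable (eta @^-1` B) by exact: measurable_preimage.
have [g gA] := cond_version_exists P mzeta mxiA.
have [h hB] := cond_version_exists P mzeta metaB.
have [g0 mg _] := gA; have [h0 mh hE] := hB.
exists (fun w => g (zeta w) * h (zeta w))%R, (g \o zeta), (h \o zeta); split.
- apply: (@cond_prob_of_version _ _ _ _ _ P zeta mzeta _ (g \* h)%R) => //.
  + exact: measurableI.
  + by move=> w; rewrite mulr_ge0.
  + exact: measurable_funM.
  + move=> D mD; rewrite -setIA PM// (ME mA _ gA); last first.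
      by apply: measurableI => //; exact: measurable_preimage.
    by rewrite (hE D (EFin \o g))//; exact/measurable_EFinP.
- apply: (@cond_prob_of_version _ _ _ _ _ P zeta mzeta _ g) => //.
    by move=> w; exact: g0.
  by move=> D mD; exact: cond_version_integral.
- apply: (@cond_prob_of_version _ _ _ _ _ P zeta mzeta _ h) => //.
    by move=> w; exact: h0.
  by move=> D mD; exact: cond_version_integral.
- exact: aeW.
Qed.

End resampling.

(** * Transport plans, their costs and the laws of pairs of coordinates *)

Lemma measurable_borel_fst (X Y : ptopologicalType) :
  measurable_fun setT (fst : borel (X * Y)%type -> borel X).
Proof. by apply: continuous_borel_measurable => ?; exact: cvg_fst. Qed.

Lemma measurable_borel_snd (X Y : ptopologicalType) :
  measurable_fun setT (snd : borel (X * Y)%type -> borel Y).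
Proof. by apply: continuous_borel_measurable => ?; exact: cvg_snd. Qed.

Lemma lower_semicontinuous_borel_measurable (R : realType) (X : ptopologicalType)
    (f : X -> \bar R) :
  lower_semicontinuous f -> measurable_fun setT (f : borel X -> \bar R).
Proof.
move=> /lower_semicontinuousP fopen.
apply: (@measurability _ _ (borel X) _ _ _ _ (ErealGenOInfty.measurableE R)).
move=> _ [_ [a ->] <-]; rewrite setTI preimage_itvoy.
by apply: sub_sigma_algebra; exact: fopen.
Qed.

Lemma borel_prod_law_eq (R : realType) d d' (T : measurableType d)
    (T' : measurableType d') (X Y : ptopologicalType)
    (P : probability T R) (Q : probability T' R)
    (p : T -> borel (X * Y)%type) (q : T' -> borel (X * Y)%type) :
  @second_countable X -> @second_countable Y ->
  measurable_fun setT p -> measurable_fun setT q ->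
  (forall (A : set (borel X)) (B : set (borel Y)), measurable A ->
    measurable B -> P (p @^-1` (A `*` B)) = Q (q @^-1` (A `*` B))) ->
  forall C : set (borel (X * Y)%type), measurable C -> P (p @^-1` C) = Q (q @^-1` C).
Proof.
move=> cX cY mp mq PQ C mC.
have [m1 m1E] := pushforward_measure_exists P mp.
have [m2 m2E] := pushforward_measure_exists Q mq.
have m1T : (m1 setT < +oo)%E.
  by rewrite m1E preimage_setT [X in (X < _)%E](probability_setT P) ltry.
rewrite -m1E -m2E; apply: (borel_prod_measure_eq cX cY m1T) => // A B mA mB.
by rewrite m1E m2E; exact: PQ.
Qed.

Section coordinates.
Context (X1 X2 Y1 Y2 : ptopologicalType).
Local Notation Z := ((X1 * X2) * (Y1 * Y2))%type.

Lemma measurable_x1 : measurable_fun setT ((fun z => z.1.1) : borel Z -> borel X1).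
Proof.
exact: (measurableT_comp (@measurable_borel_fst X1 X2)
  (@measurable_borel_fst _ _)).
Qed.

Lemma measurable_x2 : measurable_fun setT ((fun z => z.1.2) : borel Z -> borel X2).
Proof.
exact: (measurableT_comp (@measurable_borel_snd X1 X2)
  (@measurable_borel_fst _ _)).
Qed.

Lemma measurable_y1 : measurable_fun setT ((fun z => z.2.1) : borel Z -> borel Y1).
Proof.
exact: (measurableT_comp (@measurable_borel_fst Y1 Y2)
  (@measurable_borel_snd _ _)).
Qed.

Lemma measurable_y2 : measurable_fun setT ((fun z => z.2.2) : borel Z -> borel Y2).
Proof.
exact: (measurableT_comp (@measurable_borel_snd Y1 Y2)
  (@measurable_borel_snd _ _)).
Qed.

End coordinates.

Section plans.
Context (R : realType) (X1 X2 Y1 Y2 : ptopologicalType).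
Hypotheses (cX1 : @second_countable X1) (cX2 : @second_countable X2)
           (cY1 : @second_countable Y1) (cY2 : @second_countable Y2).
Local Notation Z := ((X1 * X2) * (Y1 * Y2))%type.

Lemma measurable_coord1 : measurable_fun setT
  ((fun z => (z.1.1, z.2.1)) : borel Z -> borel (X1 * Y1)%type).
Proof.
by apply: measurable_borel_pair => //; [exact: measurable_x1|exact: measurable_y1].
Qed.

Lemma measurable_coord2 : measurable_fun setT
  ((fun z => (z.1.2, z.2.2)) : borel Z -> borel (X2 * Y2)%type).
Proof.
by apply: measurable_borel_pair => //; [exact: measurable_x2|exact: measurable_y2].
Qed.

Variables (c1 : X1 * Y1 -> R) (c2 : X2 * Y2 -> R).
Hypotheses (c_ge0 : forall z, 0 <= separable_cost c1 c2 z)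
  (c_lsc : lower_semicontinuous (EFin \o separable_cost c1 c2)).

(* [c1] and [c2] may take negative values, but [c1 + c2 pt] and [c2 + c1 pt]
   are slices of [c], hence nonnegative and measurable. *)
Lemma transport_cost_split :
  exists (f : borel (X1 * Y1)%type -> \bar R)
    (g : borel (X2 * Y2)%type -> \bar R) (k : R),
  [/\ measurable_fun setT f /\ (forall p, 0 <= f p)%E,
      measurable_fun setT g /\ (forall p, 0 <= g p)%E
    & forall pi : probability (borel Z) R,
      (transport_cost (separable_cost c1 c2) pi + k%:E =
       \int[pi]_z f (z.1.1, z.2.1) + \int[pi]_z g (z.1.2, z.2.2))%E].
Proof.
set c := separable_cost c1 c2.
have mc := lower_semicontinuous_borel_measurable c_lsc.
pose i1 (p : X1 * Y1) : Z := ((p.1, point), (p.2, point)).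
pose i2 (p : X2 * Y2) : Z := ((point, p.1), (point, p.2)).
have mi1 : measurable_fun setT (i1 : borel (X1 * Y1)%type -> borel Z).
  apply: measurable_borel_pair; do ?exact: second_countable_prod.
    apply: measurable_borel_pair => //; exact: measurable_borel_fst.
  apply: measurable_borel_pair => //; exact: measurable_borel_snd.
have mi2 : measurable_fun setT (i2 : borel (X2 * Y2)%type -> borel Z).
  apply: measurable_borel_pair; do ?exact: second_countable_prod.
    apply: measurable_borel_pair => //; exact: measurable_borel_fst.
  apply: measurable_borel_pair => //; exact: measurable_borel_snd.
(* By separability, [c] on the first slice plus [c] on the second slice is [c] plus this
   constant. *)
pose k := c (point, point).
have mf := measurableT_comp mc mi1; have mg := measurableT_comp mc mi2.
exists ((EFin \o c) \o i1), ((EFin \o c) \o i2), k; split.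
- by split=> // p; rewrite lee_fin; exact: c_ge0.
- by split=> // p; rewrite lee_fin; exact: c_ge0.
move=> pi; rewrite /transport_cost.
have -> : (k%:E = \int[pi]_z k%:E)%E.
  rewrite (integral_cst pi measurableT k%:E).
  by rewrite [X in (_ * X)%E](probability_setT pi) mule1.
rewrite -!ge0_integralD//.
- apply: eq_integral => z _; rewrite /= -!EFinD /k /c /separable_cost/=.
  by congr EFin; lra.
- by move=> z _; rewrite lee_fin; exact: c_ge0.
- by apply: (measurableT_comp mf); exact: measurable_coord1.
- by move=> z _; rewrite lee_fin; exact: c_ge0.
- by apply: (measurableT_comp mg); exact: measurable_coord2.
- by move=> z _; rewrite lee_fin; exact: c_ge0.
- by move=> z _; rewrite lee_fin; exact: c_ge0.
Qed.

(** Up to a constant the cost is a sum of two integrals, each determined by the law of one of the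
    two pairs of coordinates. *)
Lemma transport_cost_eq (pi pi' : probability (borel Z) R) :
  (forall C : set (borel (X1 * Y1)%type), measurable C ->
    pi [set z | C (z.1.1, z.2.1)] = pi' [set z | C (z.1.1, z.2.1)]) ->
  (forall C : set (borel (X2 * Y2)%type), measurable C ->
    pi [set z | C (z.1.2, z.2.2)] = pi' [set z | C (z.1.2, z.2.2)]) ->
  transport_cost (separable_cost c1 c2) pi = transport_cost (separable_cost c1 c2) pi'.
Proof.
move=> law1 law2; have [f [g [k [[mf f0] [mg g0] costE]]]] := transport_cost_split.
have intE d' (T : measurableType d') (p : borel Z -> T) (h : T -> \bar R) :
    measurable_fun setT p -> measurable_fun setT h -> (forall t, 0 <= h t)%E ->
    (forall C, measurable C -> pi (p @^-1` C) = pi' (p @^-1` C)) ->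
    (\int[pi]_z h (p z) = \int[pi']_z h (p z))%E.
  move=> mp mh h0 law.
  have := @ge0_integral_pushforward _ _ _ _ _ _ mp pi setT h measurableT mh.
  have := @ge0_integral_pushforward _ _ _ _ _ _ mp pi' setT h measurableT mh.
  rewrite !preimage_setT => <-; last by move=> *; exact: h0.
  move=> <-; last by move=> *; exact: h0.
  by apply: eq_measure_integral => C mC _; exact: law.
have := costE pi; have := costE pi'.
rewrite (intE _ _ _ f measurable_coord1)// (intE _ _ _ g measurable_coord2)//.
(* The costs may be infinite, but [k] is finite and cancels. *)
by move=> <- /(congr1 (fun x => x - k%:E)%E); rewrite !addeK.
Qed.

Variables (mu : probability (borel (X1 * X2)%type) R)
          (nu : probability (borel (Y1 * Y2)%type) R)
          (pi : probability (borel Z) R).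
Hypothesis pi_unique : unique_optimal_plan mu nu (separable_cost c1 c2) pi.

(* The marginals and the separable cost only involve these four pairs of
   coordinates. *)
Lemma unique_plan_eq (pi' : probability (borel Z) R) :
  (forall (A : set (borel X1)) (B : set (borel X2)), measurable A -> measurable B ->
    pi [set z | A z.1.1 /\ B z.1.2] = pi' [set z | A z.1.1 /\ B z.1.2]) ->
  (forall (A : set (borel Y1)) (B : set (borel Y2)), measurable A -> measurable B ->
    pi [set z | A z.2.1 /\ B z.2.2] = pi' [set z | A z.2.1 /\ B z.2.2]) ->
  (forall (A : set (borel X1)) (B : set (borel Y1)), measurable A -> measurable B ->
    pi [set z | A z.1.1 /\ B z.2.1] = pi' [set z | A z.1.1 /\ B z.2.1]) ->
  (forall (A : set (borel X2)) (B : set (borel Y2)), measurable A -> measurable B ->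
    pi [set z | A z.1.2 /\ B z.2.2] = pi' [set z | A z.1.2 /\ B z.2.2]) ->
  forall C : set (borel Z), measurable C -> pi' C = pi C.
Proof.
move=> lawX lawY law1 law2.
have [[[pi_mu pi_nu] pi_opt] uniq] := pi_unique.
apply: uniq; split; last first.
  (* [pi'] inherits optimality from [pi], having the same cost. *)
  move=> pi'' /pi_opt; congr (_ <= _)%E; apply: transport_cost_eq => C mC.
    by apply: (borel_prod_law_eq cX1 cY1 measurable_coord1 measurable_coord1).
  by apply: (borel_prod_law_eq cX2 cY2 measurable_coord2 measurable_coord2).
split=> C mC.
  rewrite -pi_mu//; apply/esym.
  by apply: (borel_prod_law_eq cX1 cX2 (@measurable_borel_fst _ _)
    (@measurable_borel_fst _ _)).
rewrite -pi_nu//; apply/esym.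
by apply: (borel_prod_law_eq cY1 cY2 (@measurable_borel_snd _ _)
  (@measurable_borel_snd _ _)).
Qed.

Context d d' (Omega : measurableType d) (Omega' : measurableType d').
Variables (P : probability Omega R) (Q : probability Omega' R).
Variables (xi1 : Omega -> borel X1) (xi2 : Omega -> borel X2)
  (eta1 : Omega -> borel Y1) (eta2 : Omega -> borel Y2).
Variables (xi1' : Omega' -> borel X1) (xi2' : Omega' -> borel X2)
  (eta1' : Omega' -> borel Y1) (eta2' : Omega' -> borel Y2).
Hypothesis law : forall A : set (borel Z), measurable A ->
  P [set w | A ((xi1 w, xi2 w), (eta1 w, eta2 w))] = pi A.
Hypotheses (mxi1' : measurable_fun setT xi1') (mxi2' : measurable_fun setT xi2')
  (meta1' : measurable_fun setT eta1') (meta2' : measurable_fun setT eta2').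

(** The law of the primed vector under [Q] is a plan to which [unique_plan_eq] applies. *)
Lemma unique_plan_law :
  (forall A B, measurable A -> measurable B ->
     P (xi1 @^-1` A `&` xi2 @^-1` B) = Q (xi1' @^-1` A `&` xi2' @^-1` B)) ->
  (forall A B, measurable A -> measurable B ->
     P (eta1 @^-1` A `&` eta2 @^-1` B) = Q (eta1' @^-1` A `&` eta2' @^-1` B)) ->
  (forall A B, measurable A -> measurable B ->
     P (xi1 @^-1` A `&` eta1 @^-1` B) = Q (xi1' @^-1` A `&` eta1' @^-1` B)) ->
  (forall A B, measurable A -> measurable B ->
     P (xi2 @^-1` A `&` eta2 @^-1` B) = Q (xi2' @^-1` A `&` eta2' @^-1` B)) ->
  forall A : set (borel Z), measurable A ->
    P [set w | A ((xi1 w, xi2 w), (eta1 w, eta2 w))] =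
    Q [set w | A ((xi1' w, xi2' w), (eta1' w, eta2' w))].
Proof.
move=> lawX lawY law1 law2 C mC.
pose V w : borel Z := ((xi1' w, xi2' w), (eta1' w, eta2' w)).
have mV : measurable_fun setT V.
  by apply: measurable_borel_pair; do ?exact: second_countable_prod;
    exact: measurable_borel_pair.
have [m mE] := pushforward_measure_exists Q mV.
have [|pi' pi'E] := @probability_of_measure _ _ _ m.
  by rewrite mE preimage_setT [LHS](probability_setT Q).
have piE A : pi' A = Q (V @^-1` A) by rewrite pi'E mE.
rewrite (law mC) -[RHS](piE C); apply/esym; apply: unique_plan_eq mC => A B mA mB;
  rewrite piE -law; do ?[exact: lawX|exact: lawY|exact: law1|exact: law2].
- apply: measurableI.
    exact: (measurable_preimage (@measurable_x1 X1 X2 Y1 Y2)).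
  exact: (measurable_preimage (@measurable_x2 X1 X2 Y1 Y2)).
- apply: measurableI.
    exact: (measurable_preimage (@measurable_y1 X1 X2 Y1 Y2)).
  exact: (measurable_preimage (@measurable_y2 X1 X2 Y1 Y2)).
- apply: measurableI.
    exact: (measurable_preimage (@measurable_x1 X1 X2 Y1 Y2)).
  exact: (measurable_preimage (@measurable_y1 X1 X2 Y1 Y2)).
- apply: measurableI.
    exact: (measurable_preimage (@measurable_x2 X1 X2 Y1 Y2)).
  exact: (measurable_preimage (@measurable_y2 X1 X2 Y1 Y2)).
Qed.

End plans.

(** * Conditional independence under the unique optimal plan *)

Theorem theorem6 (R : realType) (X1 X2 Y1 Y2 : ptopologicalType)
  (polish_X1 : polish R X1) (polish_X2 : polish R X2)
  (polish_Y1 : polish R Y1) (polish_Y2 : polish R Y2)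
  (mu : probability (borel (X1 * X2)%type) R)
  (nu : probability (borel (Y1 * Y2)%type) R)
  (c1 : X1 * Y1 -> R) (c2 : X2 * Y2 -> R)
  (c_ge0 : forall z, 0 <= separable_cost c1 c2 z)
  (c_lsc : lower_semicontinuous (EFin \o separable_cost c1 c2))
  (pi : probability (borel ((X1 * X2) * (Y1 * Y2))%type) R)
  (pi_unique : unique_optimal_plan mu nu (separable_cost c1 c2) pi)
  (d : measure_display) (Omega : measurableType d) (P : probability Omega R)
  (xi1 : Omega -> X1) (xi2 : Omega -> X2)
  (eta1 : Omega -> Y1) (eta2 : Omega -> Y2)
  (vector_measurable : measurable_fun [set: Omega]
     ((fun w => ((xi1 w, xi2 w), (eta1 w, eta2 w)))
        : Omega -> borel ((X1 * X2) * (Y1 * Y2))%type))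
  (vector_law : forall A : set (borel ((X1 * X2) * (Y1 * Y2))%type),
     measurable A ->
     pushforward P
       ((fun w => ((xi1 w, xi2 w), (eta1 w, eta2 w)))
          : Omega -> borel ((X1 * X2) * (Y1 * Y2))%type) A = pi A) :
  cond_independent P (xi1 : Omega -> borel X1) (eta2 : Omega -> borel Y2)
    ((fun w => (xi2 w, eta1 w)) : Omega -> borel (X2 * Y1)%type) /\
  cond_independent P (xi2 : Omega -> borel X2) (eta1 : Omega -> borel Y1)
    ((fun w => (xi1 w, eta2 w)) : Omega -> borel (X1 * Y2)%type).
Proof.
have cX1 := polish_second_countable polish_X1.
have cX2 := polish_second_countable polish_X2.
have cY1 := polish_second_countable polish_Y1.
have cY2 := polish_second_countable polish_Y2.
have mxi1 : measurable_fun setT (xi1 : Omega -> borel X1).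
  exact: (measurableT_comp (@measurable_x1 X1 X2 Y1 Y2) vector_measurable).
have mxi2 : measurable_fun setT (xi2 : Omega -> borel X2).
  exact: (measurableT_comp (@measurable_x2 X1 X2 Y1 Y2) vector_measurable).
have meta1 : measurable_fun setT (eta1 : Omega -> borel Y1).
  exact: (measurableT_comp (@measurable_y1 X1 X2 Y1 Y2) vector_measurable).
have meta2 : measurable_fun setT (eta2 : Omega -> borel Y2).
  exact: (measurableT_comp (@measurable_y2 X1 X2 Y1 Y2) vector_measurable).
split.
- have mzeta : measurable_fun setT
      ((fun w => (xi2 w, eta1 w)) : Omega -> borel (X2 * Y1)%type).
    exact: measurable_borel_pair.
  (* In the new vector, on the product of [X1] and [Omega], [fst] replaces [xi1] and the other
     coordinates are read off the second component. *)
  have [M ME] := resampling_exists P polish_X1 mxi1 mzeta.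
  apply: (resampling_cond_independent mxi1 mzeta ME meta2) => A B D mA mB mD.
  apply: (@unique_plan_law R X1 X2 Y1 Y2 cX1 cX2 cY1 cY2 c1 c2 c_ge0 c_lsc
    mu nu pi pi_unique _ _ _ _ P M xi1 xi2 eta1 eta2
    fst (xi2 \o snd) (eta1 \o snd) (eta2 \o snd) vector_law _ _ _ _ _ _ _ _
    [set z | A z.1.1 /\ (B z.2.2 /\ D (z.1.2, z.2.1))]).
  + exact: measurable_fst.
  + exact: measurableT_comp.
  + exact: measurableT_comp.
  + exact: measurableT_comp.
  (* In the relevant pairs [xi1] is joined with [xi2] or [eta1], components of the conditioning
     vector, so [resampling_fst] applies; the pairs without [xi1] are not resampled. *)
  + move=> A1 A2 mA1 mA2.
    by rewrite -(resampling_fst mxi1 mzeta ME mA1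
      (measurable_preimage (@measurable_borel_fst _ _) mA2)).
  + move=> B1 B2 mB1 mB2; rewrite -(resampling_snd ME).
      by rewrite setTX.
    by apply: measurableI; exact: measurable_preimage.
  + move=> A1 B1 mA1 mB1.
    by rewrite -(resampling_fst mxi1 mzeta ME mA1
      (measurable_preimage (@measurable_borel_snd _ _) mB1)).
  + move=> A2 B2 mA2 mB2; rewrite -(resampling_snd ME).
      by rewrite setTX.
    by apply: measurableI; exact: measurable_preimage.
  + apply: measurableI; first exact: (measurable_preimage (@measurable_x1 X1 X2 Y1 Y2)).
    apply: measurableI; first exact: (measurable_preimage (@measurable_y2 X1 X2 Y1 Y2)).
    apply: (measurable_preimage (measurable_borel_pair cX2 cY1
      (@measurable_x2 X1 X2 Y1 Y2) (@measurable_y1 X1 X2 Y1 Y2)) mD).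
- have mzeta : measurable_fun setT
      ((fun w => (xi1 w, eta2 w)) : Omega -> borel (X1 * Y2)%type).
    exact: measurable_borel_pair.
  (* Now [xi2] is resampled; its partners [xi1] and [eta2] in the relevant pairs form the
     conditioning vector. *)
  have [M ME] := resampling_exists P polish_X2 mxi2 mzeta.
  apply: (resampling_cond_independent mxi2 mzeta ME meta1) => A B D mA mB mD.
  apply: (@unique_plan_law R X1 X2 Y1 Y2 cX1 cX2 cY1 cY2 c1 c2 c_ge0 c_lsc
    mu nu pi pi_unique _ _ _ _ P M xi1 xi2 eta1 eta2
    (xi1 \o snd) fst (eta1 \o snd) (eta2 \o snd) vector_law _ _ _ _ _ _ _ _
    [set z | A z.1.2 /\ (B z.2.1 /\ D (z.1.1, z.2.2))]).
  + exact: measurableT_comp.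
  + exact: measurable_fst.
  + exact: measurableT_comp.
  + exact: measurableT_comp.
  + move=> A1 A2 mA1 mA2; rewrite setIC [in RHS]setIC.
    by rewrite -(resampling_fst mxi2 mzeta ME mA2
      (measurable_preimage (@measurable_borel_fst _ _) mA1)).
  + move=> B1 B2 mB1 mB2; rewrite -(resampling_snd ME).
      by rewrite setTX.
    by apply: measurableI; exact: measurable_preimage.
  + move=> A1 B1 mA1 mB1; rewrite -(resampling_snd ME).
      by rewrite setTX.
    by apply: measurableI; exact: measurable_preimage.
  + move=> A2 B2 mA2 mB2.
    by rewrite -(resampling_fst mxi2 mzeta ME mA2
      (measurable_preimage (@measurable_borel_snd _ _) mB2)).
  + apply: measurableI; first exact: (measurable_preimage (@measurable_x2 X1 X2 Y1 Y2)).
    apply: measurableI; first exact: (measurable_preimage (@measurable_y1 X1 X2 Y1 Y2)).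
    apply: (measurable_preimage (measurable_borel_pair cX1 cY2
      (@measurable_x1 X1 X2 Y1 Y2) (@measurable_y2 X1 X2 Y1 Y2)) mD).
Qed.
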